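(* Let $2\le n<\infty$ and $m=(n-1)k+1$ with $k\ge 2$. Let $\omega$ be a geometric progression state on $\mathcal{O}_n$ by $z=(z_1,\ldots,z_m)\in(\mathbb{C}^m)_1$. Then $\omega$ is pure if and only if one of the following holds: (i) $|z_m|<1$; or (ii) $|z_m|=1$ and $\omega$ is the Cuntz state on $\mathcal{O}_n$ by $(0,\ldots,0,q)\in\mathbb{C}^n$ for some $k$-th root $q$ of $z_m$.
   Context: For $2\le n<\infty$, $\mathcal{O}_n$ denotes the Cuntz algebra: the universal unital C$^*$-algebra generated by $s_1,\ldots,s_n$ with $s_i^*s_j=\delta_{ij}I$ and $\sum_{i=1}^n s_is_i^*=I$. $(\mathbb{C}^m)_1$ is the set of unit vectors of $\mathbb{C}^m$. Convention: $s_n^0=I$. Geometric progression state of order $k$: for $m=(n-1)k+1$, a state $\omega$ on $\mathcal{O}_n$ is a geometric progression state by $z\in(\mathbb{C}^m)_1$ if $\omega(s_n^rs_i)=\overline{z_{(n-1)r+i}}$ for all $r=0,\ldots,k-1$ and $i=1,\ldots,n-1$, and $\omega(s_n^k)=\overline{z_m}$. Cuntz state: for a unit vector $y\in\mathbb{C}^n$, the Cuntz state on $\mathcal{O}_n$ by $y$ is the unique (and pure) state $\omega_y$ with $\omega_y(s_j)=\overline{y_j}$ for $j=1,\ldots,n$. *)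

(* Defs.v *)
From HB Require Import structures.
From mathcomp Require Import all_boot all_order all_algebra complex.
From mathcomp Require Import boolp classical_sets reals topology normedtype.

Set Implicit Arguments.
Unset Strict Implicit.
Unset Printing Implicit Defensive.

Import Order.TTheory GRing.Theory Num.Theory.
Import numFieldNormedType.Exports.

Local Open Scope ring_scope.

(* Over C, every normedModType takes its norm in C itself; cnorm follows that
   convention. The carrier cannot inherit both from the ring structures and from
   normedModType (the only join of the two hierarchies is numDomainType), so the
   norm is a new operation and the library's normed-space theory is available on
   the copy normed_space A. *)
HB.mixin Record isNormedAlgebra (K : numFieldType) A of GRing.Algebra K A := {
  cnorm : A -> K;
  ler_cnormD : forall a b : A, cnorm (a + b) <= cnorm a + cnorm b;
  cnormZ : forall (c : K) (a : A), cnorm (c *: a) = `|c| * cnorm a;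
  cnorm0_eq0 : forall a : A, cnorm a = 0 -> a = 0;
  ler_cnormM : forall a b : A, cnorm (a * b) <= cnorm a * cnorm b
}.

#[short(type="normedAlgType")]
HB.structure Definition NormedAlgebra (K : numFieldType) :=
  {A of GRing.Algebra K A & isNormedAlgebra K A}.

Definition normed_space (K : numFieldType) (A : normedAlgType K) : Type := A.

HB.instance Definition _ (K : numFieldType) (A : normedAlgType K) :=
  GRing.Lmodule.on (normed_space A).

HB.instance Definition _ (K : numFieldType) (A : normedAlgType K) :=
  @Lmodule_isNormed.Build K (normed_space A) (@cnorm K A)
    (@ler_cnormD K A) (@cnormZ K A) (@cnorm0_eq0 K A).

(* Unital C*-algebras over K, intended for K = R[i] with R : realType. They are
   nonzero, since algType requires 1 != 0. *)
HB.mixin Record isCStarAlgebra (K : numClosedFieldType) A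
    of NormedAlgebra K A := {
  cauchy_cvg_cstar : forall F : set_system (normed_space A),
    ProperFilter F -> cauchy F -> cvg F;
  star : A -> A;
  starD : forall a b : A, star (a + b) = star a + star b;
  starZ : forall (c : K) (a : A), star (c *: a) = c^* *: star a;
  starM : forall a b : A, star (a * b) = star b * star a;
  starK : forall a : A, star (star a) = a;
  cnorm_starM : forall a : A, cnorm (star a * a) = cnorm a ^+ 2
}.

#[short(type="cstarAlgType")]
HB.structure Definition CStarAlgebra (K : numClosedFieldType) :=
  {A of NormedAlgebra K A & isCStarAlgebra K A}.

HB.instance Definition _ (K : numClosedFieldType) (A : cstarAlgType K) :=
  Uniform_isComplete.Build (normed_space A) (@cauchy_cvg_cstar K A).

Section CStarAlgebras.
Variable K : numClosedFieldType.

Definition cuntz_relations (A : cstarAlgType K) (n : nat) (s : 'I_n -> A) :=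
  (forall i j, star (s i) * s j = (i == j)%:R) /\ \sum_i s i * star (s i) = 1.

Definition star_subalgebra (A : cstarAlgType K) (S : set A) :=
  [/\ S 1,
      forall (c : K) a b, S a -> S b -> S (c *: a + b),
      forall a b, S a -> S b -> S (a * b) &
      forall a, S a -> S (star a)].

Definition generates (A : cstarAlgType K) (n : nat) (s : 'I_n -> A) :=
  forall S : set A, closed (S : set (normed_space A)) -> star_subalgebra S -> (forall i, S (s i)) ->
  forall a, S a.

Definition star_morphism (A B : cstarAlgType K) (f : {lrmorphism A -> B}) :=
  forall a, f (star a) = star (f a).

(* (A, s) is O_n with its canonical generators. The morphism f below is unique
   since the s i generate A. *)
Definition is_cuntz_algebra (A : cstarAlgType K) (n : nat) (s : 'I_n -> A) :=
  [/\ cuntz_relations s,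
      generates s &
      forall (B : cstarAlgType K) (t : 'I_n -> B), cuntz_relations t ->
        exists f : {lrmorphism A -> B},
          star_morphism f /\ forall i, f (s i) = t i].

Definition is_state (A : cstarAlgType K) (omega : {scalar A}) :=
  (forall a, 0 <= omega (star a * a)) /\ omega 1 = 1.

(* Extreme points of the convex set of states. *)
Definition pure_state (A : cstarAlgType K) (omega : {scalar A}) :=
  is_state omega /\
  forall (phi psi : {scalar A}) (t : K),
    is_state phi -> is_state psi -> 0 < t < 1 ->
    (forall a, omega a = t * phi a + (1 - t) * psi a) ->
    phi =1 omega /\ psi =1 omega.

Definition unit_vector (m : nat) (z : 'rV[K]_m) := \sum_i `|z 0 i| ^+ 2 = 1.

Lemma last_ord_subproof n : (2 <= n)%N -> (n.-1 < n)%N.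
Proof. by case: n. Qed.

Definition last_ord n (hn : (2 <= n)%N) : 'I_n :=
  Ordinal (last_ord_subproof hn).

(* With 0-based indices, z_((n-1)r+i) and s_i for 1 <= i <= n-1 are the entry
   (n-1)r+i of z and the generator s i for 0 <= i < n-1; the argument of inord
   is then at most (n-1)k-1. *)
Definition geometric_progression_state (A : cstarAlgType K) (n : nat)
    (hn : (2 <= n)%N) (s : 'I_n -> A) (k : nat)
    (z : 'rV[K]_((n - 1) * k).+1) (omega : {scalar A}) :=
  [/\ is_state omega,
      unit_vector z,
      forall (r : nat) (i : 'I_n), (r < k)%N -> (i < n - 1)%N ->
        omega (s (last_ord hn) ^+ r * s i) = (z 0 (inord ((n - 1) * r + i)))^* &
      omega (s (last_ord hn) ^+ k) = (z 0 ord_max)^*].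

Definition is_cuntz_state (A : cstarAlgType K) (n : nat) (s : 'I_n -> A)
    (y : 'rV[K]_n) (omega : {scalar A}) :=
  [/\ is_state omega, unit_vector y & forall j, omega (s j) = (y 0 j)^*].

End CStarAlgebras.

(* Main.v *)
Require Import Defs.
From HB Require Import structures.
From mathcomp Require Import all_boot all_order all_algebra complex ring.
From mathcomp Require Import boolp classical_sets reals topology normedtype.

Set Implicit Arguments.
Unset Strict Implicit.
Unset Printing Implicit Defensive.

Import Order.TTheory GRing.Theory Num.Theory.
Import numFieldNormedType.Exports.

Local Open Scope ring_scope.

(* Write u for the last generator, u* and s_i* for adjoints, and Omega for the
   GNS vector of omega. The m elements u^r s_i (r < k, i < n) and u^k, call them
   t_j, are isometries with orthogonal ranges, so the unit vector
   sum_j z_j t_j Omega has inner product 1 with Omega and equals it; hence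
   t_j* Omega = z_j Omega. Every convex component of omega satisfies the same
   relations. They express the value on any word s_I s_J* through the values
   D a b on u^a u*^b with a, b < k, and 1 = sum_i s_i s_i* expresses
   D a b - D (a+1) (b+1) through z.

   If |z_m| < 1, the difference of two such states therefore satisfies
   D a b = D (a+1) (b+1) and D a k = z_m D a 0, so D 0 d = |z_m|^2 D 0 d = 0:
   omega is the only state with these relations, hence pure. The same argument
   with k = 1, where only D 0 0 = 0 is needed, shows that Cuntz states are pure.

   If |z_m| = 1, all other z_j vanish and omega (u x u* ) = omega x. For
   |c| = 1, omega is then the sum of the positive functionals
   x |-> omega (v x v* ) with v = (1 + c u) / 2 and v = (1 - c u) / 2. If omega
   is pure, both are multiples of omega; taking c = 1 and c = i gives
   omega (x u* ) = q omega x, so omega is the Cuntz state by (0, ..., 0, q). *)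

(** * Positive functionals: symmetry and Cauchy-Schwarz estimates *)

Section StarAlgebra.
Variables (K : numClosedFieldType) (A : cstarAlgType K).
Implicit Types (a b x y : A) (c : K) (phi : {scalar A}).

Fact star_is_zmod_morphism : zmod_morphism (@star K A).
Proof.
by move=> a b; rewrite -[- b]scaleN1r starD starZ rmorphN1 scaleN1r.
Qed.

HB.instance Definition _ :=
  GRing.isZmodMorphism.Build A A (@star K A) star_is_zmod_morphism.

Lemma star1 : star (1 : A) = 1.
Proof. by rewrite -[RHS]starK -[star 1 in RHS]mulr1 starM starK mulr1. Qed.

Lemma cnorm0 : cnorm (0 : A) = 0.
Proof. by rewrite -(scale0r (0 : A)) cnormZ normr0 mul0r. Qed.

Lemma cnormN a : cnorm (- a) = cnorm a.
Proof. by rewrite -scaleN1r cnormZ normrN1 mul1r. Qed.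

Lemma cnorm_ge0 a : 0 <= cnorm a.
Proof.
have := ler_cnormD a (- a).
by rewrite subrr cnorm0 cnormN -mulr2n pmulrn_lge0.
Qed.

Lemma cnormB a b : cnorm (a - b) = cnorm (b - a).
Proof. by rewrite -cnormN opprB. Qed.

Lemma cnorm_star_le a : cnorm a <= cnorm (star a).
Proof.
have [->|a0] := eqVneq (cnorm a) 0; first exact: cnorm_ge0.
have a_gt0 : 0 < cnorm a by rewrite lt_def a0 cnorm_ge0.
by rewrite -(ler_pM2r a_gt0) -expr2 -cnorm_starM ler_cnormM.
Qed.

Lemma cnorm_star a : cnorm (star a) = cnorm a.
Proof.
apply/le_anti/andP; split; last exact: cnorm_star_le.
by have := cnorm_star_le (star a); rewrite starK.
Qed.

Definition positive phi := forall a, 0 <= phi (star a * a).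
Definition hermitian_functional phi := forall a, phi (star a) = (phi a)^*.

(** Real values on the squares of [a + c%:A] make [c * phi (star a) + c^* * phi a] real; [c = 1] and
    [c = 'i] then determine [phi (star a)]. *)
Lemma positive_hermitian phi : positive phi -> hermitian_functional phi.
Proof.
move=> pos a.
have real_sq b : phi (star b * b) \is Num.real by apply/ger0_real/pos.
have expand c : c * phi (star a) + c^* * phi a \is Num.real.
  have := rpredB (real_sq (a + c%:A)) (rpredD (real_sq a) (real_sq c%:A)).
  rewrite raddfD /= starZ star1 !mulrDl !mulrDr -!scalerAl -!scalerAr.
  rewrite !mulr1 !mul1r !(linearB, linearD, linearN, scalarZ) /=.
  apply: etrans; congr (in_mem _ _); ring.
have /CrealP := expand 1; have /CrealP := expand 'i.
rewrite !(rmorphD, rmorphM, rmorph1) /= conjCK conjCi !mul1r.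
set u := phi (star a); set v := phi a => Hi H1.
have {}Hi : - u^* + v^* = u - v.
  apply: (mulfI (neq0Ci K)); rewrite !mulrDr; move: Hi => /=.
  by rewrite !mulrN !mulNr.
apply: (mulfI (x := 2)); first by rewrite pnatr_eq0.
have -> : 2 * u = (u - v) + (u + v) by ring.
by rewrite -Hi -H1; ring.
Qed.

(** Otherwise, perturbing [b] by a small multiple of [star x] would give a square with a negative
    value. *)
Lemma positive_null phi b x :
  positive phi -> phi (star b * b) = 0 -> phi (x * b) = 0.
Proof.
move=> pos b0.
have herm := positive_hermitian pos.
set beta := phi (x * b); set M := phi (x * star x).
have M0 : 0 <= M by rewrite /M -{1}(starK x) pos.
(* The summand 1 covers [M = 0]; since [t * M = 1 - t], the test value is minus [t * (1 + t)] times
   the squared modulus of [beta]. *)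
set t := (M + 1)^-1.
have t0 : 0 < t by rewrite invr_gt0 ltr_wpDl.
have := pos (b + (- (t * beta)) *: star x).
rewrite raddfD /= starZ starK !mulrDl !mulrDr -!scalerAl -!scalerAr.
rewrite !linearD !scalarZ /= b0 -starM herm -/beta -/M.
rewrite rmorphN rmorphM /= (CrealP (gtr0_real t0)) => pos_t.
have tM : t * M = 1 - t.
  by rewrite /t; field; rewrite gt_eqF// ltr_wpDl.
have {}pos_t : 0 <= - (t * (1 + t)) * (beta * beta^*).
  apply: le_trans pos_t _; rewrite le_eqVlt; apply/predU1P; left.
  transitivity (- 2 * t * (beta * beta^*) + t * (t * M) * (beta * beta^*)).
    by ring.
  by rewrite tM; ring.
apply/eqP; rewrite -mul_conjC_eq0 eq_le mul_conjC_ge0 andbT.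
have tt : 0 < t * (1 + t) by rewrite mulr_gt0// addr_gt0.
by move: pos_t; rewrite mulNr oppr_ge0 pmulr_rle0.
Qed.

(** The variance of [x], that is [phi] on the square of [x - (phi x)%:A], is nonnegative. *)
Lemma state_sqr phi x : is_state phi -> `|phi x| ^+ 2 <= phi (star x * x).
Proof.
move=> [pos phi1]; have herm := positive_hermitian pos.
have := pos (x - (phi x)%:A).
rewrite raddfB /= starZ star1 !mulrBl !mulrBr -!scalerAl -!scalerAr.
rewrite !mulr1 !mul1r !linearB !scalarZ /= phi1 herm.
move=> pos_x; rewrite -subr_ge0 normCK; apply: le_trans pos_x _.
by rewrite le_eqVlt; apply/predU1P; left; ring.
Qed.

End StarAlgebra.

(** * Boundedness of states, through square roots near the identity *)

Section BoundedFunctionals.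
Variables (R : realType) (A : cstarAlgType R[i]).
Implicit Types (a b x y : A) (phi : {scalar A}).

Lemma le_small_eq0 (u M : R[i]) :
  0 <= u -> 0 < M -> (forall e, 0 < e -> u <= M * e) -> u = 0.
Proof.
move=> u0 M0 small; apply/eqP; apply: contraT => u_neq0.
have u_gt0 : 0 < u by rewrite lt_def u_neq0.
have MV0 : M != 0 by rewrite gt_eqF.
have /small : 0 < u / (2 * M) by rewrite divr_gt0// mulr_gt0.
have -> : M * (u / (2 * M)) = u / 2 by field.
rewrite ler_pdivlMr// mulrDr mulr1 gerDl => /(lt_le_trans u_gt0).
by rewrite ltxx.
Qed.

(** A Lipschitz bound replaces linearity because [g] may also be conjugate-linear, through
    [star x]. *)
Lemma closed_eq0 (g : A -> R[i]) (M : R[i]) : 0 < M ->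
  (forall x y, `|g x - g y| <= M * cnorm (x - y)) ->
  closed ([set x | g x = 0]%classic : set (normed_space A)).
Proof.
move=> M0 gM x clx; apply/normr0_eq0/(le_small_eq0 _ M0) => // e e0.
have [y [/= gy0 xy]] := clx _ (nbhsx_ballx (x : normed_space A) e e0).
move: xy; rewrite -ball_normE /= => xy.
by rewrite -(subr0 (g x)) -gy0 (le_trans (gM x y))// ler_pM2l// ltW.
Qed.

Lemma half_exp_lt (e : R[i]) : 0 < e -> exists m, 2^-1 ^+ m < e.
Proof.
move=> e0; have e_real : (complex.Re e)%:C%C = e by rewrite RRe_real ?gtr0_real.
have re0 : 0 < complex.Re e by rewrite -ltcR e_real.
exists (Num.bound (complex.Re e)^-1).
have -> : 2^-1 = (2^-1)%:C%C :> R[i] by rewrite fmorphV rmorph_nat.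
rewrite -rmorphXn -e_real ltcR exprVn invf_plt ?posrE ?exprn_gt0//.
exact: upper_nthrootP.
Qed.

Section SquareRoot.
Variable a : A.
Hypothesis a_small : cnorm a <= 2^-1.

(** A fixed point [y] satisfies (1 - y)^2 = 1 - a. On the ball of radius 1/2 this map contracts by
    the factor 1/2. *)
Let step y : A := 2^-1 *: (a + y * y).
Let appr m : A := iter m step 0.

Let step_dist y w :
  cnorm (step y - step w) <= 2^-1 * ((cnorm y + cnorm w) * cnorm (y - w)).
Proof.
rewrite -scalerBr cnormZ ger0_norm ?invr_ge0// ler_pM2l ?invr_gt0//.
rewrite opprD addrACA subrr add0r.
have -> : y * y - w * w = y * (y - w) + (y - w) * w.
  by rewrite mulrBr mulrBl addrA subrK.
rewrite (le_trans (ler_cnormD _ _))// [leRHS]mulrDl [X in _ <= _ + X]mulrC.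
by rewrite lerD// ler_cnormM.
Qed.

Let appr_bound m : cnorm (appr m) <= 2^-1.
Proof.
elim: m => [|m IHm]; first by rewrite cnorm0 invr_ge0.
rewrite /= cnormZ ger0_norm ?invr_ge0// -[leRHS]mulr1 ler_pM2l ?invr_gt0//.
rewrite (le_trans (ler_cnormD _ _))//.
have -> : 1 = 2^-1 + 2^-1 :> R[i] by field.
rewrite lerD// (le_trans (ler_cnormM _ _))//.
rewrite -[leRHS]mulr1 ler_pM ?cnorm_ge0//.
by rewrite (le_trans IHm)// invf_le1// ler1n.
Qed.

Let appr_cauchy m p : cnorm (appr (m + p) - appr m) <= 2^-1 ^+ m.
Proof.
elim: m => [|m IHm].
  by rewrite subr0 expr0 (le_trans (appr_bound _))// invf_le1// ler1n.
rewrite addSn /= (le_trans (step_dist _ _))// exprS ler_pM2l ?invr_gt0//.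
apply: le_trans IHm; rewrite ler_piMl ?cnorm_ge0//.
have -> : 1 = 2^-1 + 2^-1 :> R[i] by field.
by rewrite lerD.
Qed.

Let appr_limit : exists y, forall e, 0 < e -> exists m,
  cnorm (y - appr m) < e /\ cnorm (y - appr m.+1) < e.
Proof.
pose u : nat -> normed_space A := appr.
have : cvg (u @ \oo)%classic.
  apply: cauchy_cvg_cstar; apply: cauchy_exP => e e0.
  have [m me] := half_exp_lt e0; exists (u m).
  exists m => // p /= mp; rewrite -ball_normE /= -opprB normrN.
  by rewrite -(subnKC mp); apply: le_lt_trans me; apply: appr_cauchy.
move=> /cvg_ex[y uy]; exists y => e e0.
move/cvgrPdist_lt: uy => /(_ _ e0)[m _ um].
by exists m; split; [exact: (um m (leqnn m))|exact: (um m.+1 (leqnSn m))].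
Qed.

Lemma sub1_eq_star_mul :
  star a = a -> exists b, star b * b = 1 - a.
Proof.
move=> sa; have [y ylim] := appr_limit.
have sappr m : star (appr m) = appr m.
  elim: m => [|m IHm]; first exact: raddf0.
  by rewrite /= starZ starD starM IHm sa fmorphV rmorph_nat.
have sy : star y = y.
  apply/eqP; rewrite -subr_eq0; apply/eqP/cnorm0_eq0.
  apply: (le_small_eq0 (M := 2)); rewrite ?cnorm_ge0// => e /ylim[m [ym _]].
  rewrite -[star y](subrK (star (appr m))) -addrA mulrDl !mul1r.
  rewrite (le_trans (ler_cnormD _ _))// lerD//.
    by rewrite -raddfB cnorm_star ltW.
  by rewrite sappr cnormB ltW.
have fixy : y = step y.
  apply/eqP; rewrite -subr_eq0; apply/eqP/cnorm0_eq0.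
  (* The 1 accounts for [y - appr m.+1], the rest is the Lipschitz factor of [step] between [appr m]
     and [y]. *)
  have M0 : 0 < 1 + 2^-1 * (2^-1 + cnorm y).
    by rewrite ltr_wpDr// mulr_ge0 ?addr_ge0 ?cnorm_ge0 ?invr_ge0.
  apply: (le_small_eq0 _ M0) => [|e]; first exact: cnorm_ge0.
  move=> /[dup] e0 /ylim[m [ym ym1]].
  have -> : y - step y = (y - appr m.+1) + (step (appr m) - step y).
    by rewrite addrA subrK.
  rewrite mulrDl mul1r (le_trans (ler_cnormD _ _))// lerD ?(ltW ym1)//.
  rewrite (le_trans (step_dist _ _))// -mulrA ler_pM2l ?invr_gt0//.
  apply: ler_pM; rewrite ?addr_ge0 ?cnorm_ge0 ?lerD2r ?appr_bound//.
  by rewrite cnormB ltW.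
exists (1 - y); rewrite raddfB /= star1 sy mulrBl mul1r mulrBr mulr1.
have -> : a = 2 *: y - y * y.
  by rewrite {1}fixy scalerA divff ?pnatr_eq0// scale1r addrK.
by rewrite scaler_nat mulr2n !opprD !addrA.
Qed.

End SquareRoot.

Definition bounded_functional phi :=
  exists2 M : R[i], 0 < M & forall x, `|phi x| <= M * cnorm x.

(** For self-adjoint nonzero [h] scaled to norm 1/2, 1 minus it is a square, so
    [phi h <= 2 * cnorm h]. This is applied to [star x * x] after [state_sqr]. *)
Lemma state_bounded phi : is_state phi -> bounded_functional phi.
Proof.
move=> st; have [pos phi1] := st.
have sa_bound h : star h = h -> phi h <= 2 * cnorm h.
  move=> sh; have [h0|h_neq0] := eqVneq (cnorm h) 0.
    by rewrite h0 (cnorm0_eq0 _ h0) linear0 mulr0.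
  have h_gt0 : 0 < cnorm h by rewrite lt_def h_neq0 cnorm_ge0.
  have h2_gt0 : 0 < (2 * cnorm h)^-1 by rewrite invr_gt0 mulr_gt0.
  have small : cnorm ((2 * cnorm h)^-1 *: h) <= 2^-1.
    rewrite cnormZ (ger0_norm (ltW h2_gt0)) le_eqVlt; apply/predU1P; left.
    by field.
  have sa : star ((2 * cnorm h)^-1 *: h) = (2 * cnorm h)^-1 *: h.
    by rewrite starZ sh (CrealP (gtr0_real h2_gt0)).
  have [b bE] := sub1_eq_star_mul small sa.
  have := pos b; rewrite bE linearB scalarZ /= phi1 subr_ge0.
  by rewrite mulrC ler_pdivrMr ?mul1r// mulr_gt0.
exists 2 => // x; rewrite -(ler_pXn2r (n := 2)) ?nnegrE ?mulr_ge0 ?cnorm_ge0//.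
rewrite (le_trans (state_sqr x st))//.
rewrite (le_trans (sa_bound _ _)) ?starM ?starK// cnorm_starM exprMn.
by rewrite ler_wpM2r ?exprn_ge0 ?cnorm_ge0// -natrX ler_nat.
Qed.

Lemma bounded_functionalB phi psi :
  bounded_functional phi -> bounded_functional psi ->
  bounded_functional (phi \- psi).
Proof.
move=> [M M0 phiM] [N N0 psiN]; exists (M + N); first exact: addr_gt0.
by move=> x /=; rewrite mulrDl (le_trans (ler_normB _ _))// lerD.
Qed.

Section Sandwich.
Variables (phi : {scalar A}) (u v : A).

(** Besides compressions, this covers scalar multiples of [phi], with [u = c%:A] and [v = 1]. *)
Definition sandwich x := phi (u * x * v).

Fact sandwich_is_scalar : scalar sandwich.
Proof.
move=> c x y; rewrite /sandwich.
by rewrite mulrDr mulrDl -scalerAr -scalerAl linearP.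
Qed.

HB.instance Definition _ :=
  GRing.isLinear.Build R[i] A R[i] *%R sandwich sandwich_is_scalar.

Lemma sandwich_bounded : bounded_functional phi -> bounded_functional sandwich.
Proof.
move=> [M M0 phiM]; exists (M * ((cnorm u + 1) * (cnorm v + 1))).
  by rewrite !mulr_gt0// ltr_wpDl ?cnorm_ge0.
move=> x; rewrite (le_trans (phiM _))// -[leRHS]mulrA ler_pM2l//.
rewrite (le_trans (ler_cnormM _ _))// [leRHS]mulrAC.
rewrite ler_pM ?cnorm_ge0 ?lerDl//.
rewrite (le_trans (ler_cnormM _ _))// ler_wpM2r ?cnorm_ge0 ?lerDl//.
Qed.

End Sandwich.

End BoundedFunctionals.

(** * Bounded functionals on the Cuntz algebra determined by few values *)

Section CuntzAlgebra.
Variables (R : realType) (A : cstarAlgType R[i]) (n : nat) (s : 'I_n -> A).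
Hypothesis s_rel : cuntz_relations s.
Implicit Types (x y : A) (I J : seq 'I_n) (phi delta omega : {scalar A}).

Definition word I : A := \prod_(i <- I) s i.

(** Density of the span of words is replaced by an invariance argument: [N] contains 1, and the
    elements that preserve [N] together with their adjoints form a closed star-subalgebra [S]
    containing the generators. *)
Lemma bounded_functional_eq0 delta : generates s -> bounded_functional delta ->
  (forall I J, delta (word I * star (word J)) = 0) -> forall x, delta x = 0.
Proof.
move=> gen bdd dwords x.
pose N y := forall I J, delta (word I * star (word J) * y) = 0.
have Ns i y : N y -> N (s i * y).
  move=> Ny I [|j J].
    rewrite /word big_nil star1 mulr1 mulrA.
    by have := Ny (rcons I i) [::]; rewrite /word big_nil star1 mulr1 big_rcons.
  rewrite /word big_cons starM -!mulrA (mulrA (star (s j))).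
  rewrite s_rel.1; case: eqP => _; last by rewrite mul0r !mulr0 linear0.
  by rewrite mul1r mulrA Ny.
have Nsstar i y : N y -> N (star (s i) * y).
  move=> Ny I J; have := Ny I (i :: J).
  by rewrite /word big_cons starM !mulrA.
pose S := [set x | forall y, N y -> N (x * y) /\ N (star x * y)]%classic.
suff Sall : S x.
  have N1 : N 1 by move=> I J; rewrite mulr1.
  have [+ _] := Sall 1 N1; move/(_ [::] [::]).
  by rewrite /word big_nil star1 !mul1r mulr1.
move: x; apply: gen.
- have gM u v : exists2 M, 0 < M & forall x y,
      `|delta (u * x * v) - delta (u * y * v)| <= M * cnorm (x - y).
    have [M M0 sM] := sandwich_bounded u v bdd.
    exists M => // x1 x2; rewrite -linearB /= -mulrBl -mulrBr; exact: sM.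
  move=> x clx y Ny; split=> I J; rewrite mulrA.
    have [M M0 dM] := gM (word I * star (word J)) y.
    apply: (closed_eq0 M0 dM); apply: (closureS _ clx) => x' Sx' /=.
    by have [+ _] := Sx' y Ny; move/(_ I J); rewrite mulrA.
  have [M M0 dM] := gM (word I * star (word J)) y.
  have dM' x1 x2 : `|delta (word I * star (word J) * star x1 * y) -
      delta (word I * star (word J) * star x2 * y)| <= M * cnorm (x1 - x2).
    by rewrite -cnorm_star raddfB.
  apply: (closed_eq0 M0 dM'); apply: (closureS _ clx) => x' Sx' /=.
  by have [_] := Sx' y Ny; move/(_ I J); rewrite mulrA.
- split=> [y Ny|c a b Sa Sb y Ny|a b Sa Sb y Ny|a Sa y Ny].
  + by rewrite star1 mul1r.
  + have [[Na Na'] [Nb Nb']] := (Sa y Ny, Sb y Ny).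
    split=> I J; rewrite ?starD ?starZ mulrDl mulrDr -scalerAl -scalerAr.
      by rewrite linearP Na Nb mulr0 addr0.
    by rewrite linearP Na' Nb' mulr0 addr0.
  + rewrite starM -!mulrA; split; first exact/(Sa _ _).1/(Sb _ _).1.
    exact/(Sb _ _).2/(Sa _ _).2.
  + by rewrite starK; have [] := Sa y Ny.
- by move=> i y Ny; split; [exact: Ns|exact: Nsstar].
Qed.

Variable l : 'I_n.
Let sl := s l.

Lemma starX_mulX r : star (sl ^+ r) * sl ^+ r = 1.
Proof.
elim: r => [|r IHr]; first by rewrite star1 mulr1.
rewrite exprS starM -mulrA (mulrA (star sl)).
by rewrite s_rel.1 eqxx mul1r.
Qed.

Lemma star_progression_orthogonal r r' i x : (r < r')%N -> i != l ->
  star (sl ^+ r * s i) * (sl ^+ r' * x) = 0.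
Proof.
move=> /subnKC <- /negbTE i_l.
rewrite addSnnS exprD exprS starM -!mulrA (mulrA (star (sl ^+ r))) starX_mulX.
by rewrite mul1r mulrA s_rel.1 i_l mul0r.
Qed.

Lemma expand_powers a b : sl ^+ a * star (sl ^+ b) =
  sl ^+ a.+1 * star (sl ^+ b.+1) +
  \sum_(i | i != l) sl ^+ a * s i * star (sl ^+ b * s i).
Proof.
rewrite -[sl ^+ a]mulr1 -{1}s_rel.2 mulr_sumr mulr_suml (bigD1 l)//=; congr +%R.
  by rewrite !exprSr starM !mulrA.
by apply: eq_bigr => i _; rewrite mulr1 starM !mulrA.
Qed.

(* The vector Omega of the GNS representation of delta satisfies
   star (sl ^+ r * s i) Omega = zeta r i Omega for r < k and i != l, and
   star (sl ^+ k) Omega = zm Omega. *)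
Definition progression k (zeta : nat -> 'I_n -> R[i]) (zm : R[i])
    (delta : A -> R[i]) :=
  (forall r i x, (r < k)%N -> i != l ->
     delta (x * star (sl ^+ r * s i)) = zeta r i * delta x) /\
  (forall x, delta (x * star (sl ^+ k)) = zm * delta x).

Section Progression.
Variables (k : nat) (zeta : nat -> 'I_n -> R[i]) (zm : R[i]).
Hypothesis k_gt0 : (0 < k)%N.

Lemma progressionB phi psi : progression k zeta zm phi ->
  progression k zeta zm psi -> progression k zeta zm (phi \- psi).
Proof.
move=> [p1 p2] [q1 q2]; split=> [r i x rk il|x] /=.
  by rewrite p1// q1// mulrBr.
by rewrite p2 q2 mulrBr.
Qed.

(** Letters are absorbed one by one: [s l] raises the exponent, any other letter becomes a scalar
    and resets it to 0, and reaching exponent [k] yields [zm] and also resets it. *)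
Lemma progression_word delta : progression k zeta zm delta ->
  forall J r, (r < k)%N -> exists c r', (r' < k)%N /\
    forall x, delta (x * star (word J) * star (sl ^+ r)) =
              c * delta (x * star (sl ^+ r')).
Proof.
move=> [prog_s prog_k]; elim=> [|j J IHJ] r rk.
  by exists 1, r; split=> // x; rewrite /word big_nil star1 mulr1 mul1r.
have word_cons x : x * star (word (j :: J)) * star (sl ^+ r) =
    x * star (word J) * star (sl ^+ r * s j).
  by rewrite /word big_cons !starM !mulrA.
have [c [r' [r'k redJ]]] := IHJ 0%N k_gt0.
have {}redJ x : delta (x * star (word J)) = c * delta (x * star (sl ^+ r')).
  by rewrite -redJ star1 mulr1.
have [j_l|j_l] := eqVneq j l; last first.
  exists (zeta r j * c), r'; split=> // x.
  by rewrite word_cons prog_s// redJ mulrA.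
have [r1k|] := ltnP r.+1 k.
  have [c1 [r1 [r1k' redJ1]]] := IHJ _ r1k.
  by exists c1, r1; split=> // x; rewrite word_cons j_l -exprSr redJ1.
move=> k_le; have kE : r.+1 = k by apply/anti_leq; rewrite rk k_le.
exists (zm * c), r'; split=> // x.
by rewrite word_cons j_l -exprSr kE prog_k redJ mulrA.
Qed.

(** [progression_word] reduces the right factor of a word to a power; symmetry under [star] lets it
    reduce the left factor too. *)
Lemma progression_eq0 delta : generates s -> bounded_functional delta ->
  hermitian_functional delta -> progression k zeta zm delta ->
  (forall a b, (a < k)%N -> (b < k)%N ->
    delta (sl ^+ a * star (sl ^+ b)) = 0) ->
  forall x, delta x = 0.
Proof.
move=> gen bdd herm prog d0; apply: bounded_functional_eq0 => // I J.
have [c [b [bk redJ]]] := progression_word prog J k_gt0.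
have [c' [a [ak redI]]] := progression_word prog I k_gt0.
have := redJ (word I); rewrite star1 mulr1 => ->.
rewrite -[word I * _]starK starM starK herm.
have := redI (sl ^+ b); rewrite star1 mulr1 => ->.
by rewrite d0// mulr0 conjC0 mulr0.
Qed.

Lemma progression_unique delta : generates s -> bounded_functional delta ->
  hermitian_functional delta -> progression k zeta zm delta ->
  `|zm| < 1 -> delta 1 = 0 ->
  forall x, delta x = 0.
Proof.
move=> gen bdd herm prog zm1 d1; have [prog_s prog_k] := prog.
pose D a b := delta (sl ^+ a * star (sl ^+ b)).
have Dstar a b : D a b = (D b a)^*.
  by rewrite /D -herm starM starK.
have Dstep a b : (a < k)%N -> (b < k)%N -> D a b = D a.+1 b.+1.
  move=> ak bk; rewrite /D expand_powers linearD linear_sum /=.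
  rewrite big1 ?addr0// => i il; rewrite prog_s//.
  rewrite -[sl ^+ a * s i]starK herm -[star _]mul1r prog_s//.
  by rewrite d1 mulr0 conjC0 mulr0.
have Dshift a b j : (a + j <= k)%N -> (b + j <= k)%N ->
    D a b = D (a + j)%N (b + j)%N.
  elim: j => [|j IHj]; first by rewrite !addn0.
  by rewrite !addnS => ak bk; rewrite (IHj (ltnW ak) (ltnW bk)) Dstep.
have Dk a : D a k = zm * D a 0%N by rewrite /D prog_k star1 mulr1.
have D0 d : (d <= k)%N -> D 0%N d = 0.
  move=> dk; apply/eqP; apply: contraT => D_neq0.
  have kd : (k - d <= k)%N by rewrite leq_subr.
  (* The pair (0, d) moves to (k - d, k), which releases [zm] and leaves the conjugate of the value
     at (0, k - d); moving that pair to (d, k) releases the conjugate of [zm]. *)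
  have : D 0%N d = zm * zm^* * D 0%N d.
    rewrite {1}(Dshift _ _ (k - d)%N) ?add0n ?subnKC// Dk Dstar.
    by rewrite (Dshift _ _ d) ?add0n ?subnK// Dk rmorphM /= -Dstar mulrA.
  rewrite -{1}[D 0%N d]mul1r => /(mulIf D_neq0)/eqP.
  by rewrite -normCK eq_sym sqrp_eq1 ?normr_ge0// lt_eqF.
apply: progression_eq0 => // a b ak bk; rewrite -/(D a b).
wlog ab : a b ak bk / (a <= b)%N.
  move=> wlog_ab; have [/wlog_ab->//|/ltnW ba] := leqP a b.
  by rewrite Dstar wlog_ab// conjC0.
have := Dshift 0%N (b - a)%N a; rewrite add0n subnK// => <-; try exact: ltnW.
by rewrite D0// (leq_trans (leq_subr _ _))// ltnW.
Qed.

End Progression.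
End CuntzAlgebra.

(** * Purity, faces of the state space and eigenvector relations *)

Section States.
Variables (R : realType) (A : cstarAlgType R[i]).
Implicit Types (x y : A) (phi psi omega : {scalar A}).

Lemma sandwich_positive phi u :
  positive phi -> positive (sandwich phi u (star u)).
Proof.
move=> pos a; have := pos (a * star u).
by rewrite /= /sandwich starM starK !mulrA.
Qed.

Lemma hermitian_functionalB phi psi : hermitian_functional phi ->
  hermitian_functional psi -> hermitian_functional (phi \- psi).
Proof. by move=> hphi hpsi a; rewrite /= hphi hpsi rmorphB. Qed.

(** The states vanishing at a positive element form a face, and a one-point face is an extreme
    point. *)
Lemma unique_pure omega b : is_state omega -> omega (star b * b) = 0 ->
  (forall phi, is_state phi -> phi (star b * b) = 0 -> phi =1 omega) ->
  pure_state omega.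
Proof.
move=> st b0 uniq; split=> // phi psi t st1 st2 /andP[t0 t1] omegaE.
have := omegaE (star b * b); rewrite b0 => /esym/eqP.
have t'0 : 0 < 1 - t by rewrite subr_gt0.
have [phi_ge0 psi_ge0] := (st1.1 b, st2.1 b).
rewrite (paddr_eq0 (mulr_ge0 (ltW t0) phi_ge0) (mulr_ge0 (ltW t'0) psi_ge0)).
rewrite !mulf_eq0 (gt_eqF t0) (gt_eqF t'0) => /andP[/eqP phi0 /eqP psi0].
by split; apply: uniq.
Qed.

Lemma positive_rescale psi (c : R[i]) : 0 <= c -> positive psi ->
  positive (sandwich psi c%:A 1).
Proof.
move=> c0 pos a; rewrite /= /sandwich mulr1 -scalerAl mul1r scalarZ /=.
by apply: mulr_ge0 => //; apply: pos.
Qed.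

(** [omega] is the convex combination of the normalised [psi] and [omega \- psi], with weight
    [psi 1] on the first. Weights 0 and 1 are treated apart: a positive functional vanishing at 1 is
    zero. *)
Lemma pure_component omega psi : pure_state omega -> positive psi ->
  positive (omega \- psi) -> forall x, psi x = psi 1 * omega x.
Proof.
move=> [[_ omega1] extreme] pos1 pos2 x.
have pos_1 (phi : {scalar A}) : positive phi -> 0 <= phi 1.
  by move/(_ 1); rewrite star1 mulr1.
have null (phi : {scalar A}) : positive phi -> phi 1 = 0 -> phi x = 0.
  by move=> pos phi1; rewrite -[x]mulr1 positive_null// star1 mulr1.
set lam := psi 1.
have lam0 : 0 <= lam by exact: pos_1.
have lam1 : 0 <= 1 - lam by rewrite -omega1; exact: (pos_1 _ pos2).
have [lamE|lam_neq0] := eqVneq lam 0; first by rewrite lamE mul0r null.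
have [lamE|lam_neq1] := eqVneq (1 - lam) 0.
  have /eqP : (omega \- psi) x = 0 by apply: null; rewrite //= omega1.
  move/eqP: lamE; rewrite /= !subr_eq0 => /eqP <- /eqP <-.
  by rewrite mul1r.
pose phi1 : {scalar A} := sandwich psi lam^-1%:A 1.
pose phi2 : {scalar A} := sandwich (omega \- psi) (1 - lam)^-1%:A 1.
have phi1E y : phi1 y = lam^-1 * psi y.
  by rewrite /phi1 /= /sandwich mulr1 -scalerAl mul1r scalarZ.
have phi2E y : phi2 y = (1 - lam)^-1 * (omega y - psi y).
  by rewrite /phi2 /= /sandwich /= mulr1 -scalerAl mul1r !scalarZ mulrBr.
have st1 : is_state phi1.
  split; last by rewrite phi1E mulVf.
  by apply: positive_rescale => //; rewrite invr_ge0.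
have st2 : is_state phi2.
  split; last by rewrite phi2E omega1 mulVf.
  by apply: positive_rescale => //; rewrite invr_ge0.
have lam01 : 0 < lam < 1.
  by rewrite lt_def lam_neq0 lam0 -subr_gt0 lt_def lam_neq1.
have [|+ _] := extreme _ _ _ st1 st2 lam01.
  by move=> y; rewrite phi1E phi2E !mulVKf// addrC subrK.
by move/(_ x); rewrite phi1E => <-; rewrite mulVKf.
Qed.

Section IsometryFamily.
Variables (F : finType) (t : F -> A) (z : F -> R[i]).
Hypothesis t_orth : forall f g, star (t f) * t g = (f == g)%:R.

(* ||Omega - sum_f z_f t_f Omega||^2 = 0, where Omega is the GNS vector. *)
Lemma unit_family_eigenvector omega : is_state omega ->
    \sum_f `|z f| ^+ 2 = 1 -> (forall f, omega (t f) = (z f)^*) ->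
  exists2 b, omega (star b * b) = 0 &
    forall phi, positive phi -> phi (star b * b) = 0 ->
      forall f x, phi (x * star (t f)) = z f * phi x.
Proof.
move=> [pos omega1] z1 omega_t.
pose a := \sum_f z f *: t f.
have ta f : star (t f) * a = z f *: 1.
  rewrite mulr_sumr (bigD1 f)//= -scalerAr t_orth eqxx big1 ?addr0// => g g_f.
  by rewrite -scalerAr t_orth eq_sym (negbTE g_f) scaler0.
have aa : star a * a = 1.
  rewrite {1}/a raddf_sum mulr_suml -[RHS]scale1r -z1 scaler_suml.
  apply: eq_bigr => f _.
  by rewrite /= starZ -scalerAl ta scalerA normCK mulrC.
have omega_a : omega a = 1.
  rewrite linear_sum -z1; apply: eq_bigr => f _.
  by rewrite scalarZ omega_t normCK.
exists (a - 1).
  rewrite raddfB /= star1 mulrBl mul1r mulrBr mulr1 aa !linearB /=.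
  by rewrite (positive_hermitian pos) omega_a omega1 rmorph1  !subrr addr0.
move=> phi phi_pos /(positive_null _ phi_pos) null f x.
have /eqP := null (x * star (t f)).
rewrite mulrBr mulr1 -mulrA ta -scalerAr mulr1 linearB scalarZ subr_eq0.
by move/eqP.
Qed.

End IsometryFamily.
End States.

(** * The isometries of the progression, and its two regimes *)

Section GeometricProgression.
Variables (R : realType) (A : cstarAlgType R[i]) (n : nat) (s : 'I_n -> A).
Hypotheses (s_rel : cuntz_relations s) (s_gen : generates s).
Implicit Types (x y : A) (phi omega : {scalar A}).

Section Family.
Variables (l : 'I_n) (d k : nat).
Hypotheses (d_gt0 : (0 < d)%N) (lE : l = d :> nat).
Let sl := s l.

(** Quotient and remainder by [d] give exponent and generator, in the order of the entries of [z].
    For [d > 0] the remainder is a valid index below [l], so the default of [insubd] never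
    occurs. *)
Definition progression_family (j : nat) : A :=
  sl ^+ (j %/ d) * (if (j < d * k)%N then s (insubd l (j %% d)%N) else 1).

Let insubd_lt j : (j < d)%N -> insubd l j = j :> nat.
Proof. by move=> jd; rewrite val_insubd (ltn_trans jd)// -lE. Qed.

Let insubd_neq j : (j < d)%N -> insubd l j != l.
Proof. by move=> jd; rewrite -val_eqE /= insubd_lt// lE ltn_eqF. Qed.

Let div_ltE j : (j %/ d < k)%N = (j < d * k)%N.
Proof. by rewrite ltn_divLR// mulnC. Qed.

Lemma progression_familyE r (i : 'I_n) : (r < k)%N -> (i < d)%N ->
  progression_family (d * r + i) = sl ^+ r * s i.
Proof.
move=> rk id; have rE : ((d * r + i) %/ d = r)%N.
  by rewrite mulnC divnMDl// divn_small// addn0.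
rewrite /progression_family -div_ltE rE rk mulnC modnMDl modn_small//.
by congr (_ * s _); apply: val_inj; rewrite /= insubd_lt.
Qed.

Lemma progression_family_last : progression_family (d * k) = sl ^+ k.
Proof. by rewrite /progression_family ltnn mulr1 mulKn. Qed.

(** If the quotients differ, the smaller power cancels and a generator other than [s l] meets [s l].
    Equal quotients below [k] leave two generators to compare; quotient [k] occurs only at the last
    index. *)
Lemma progression_family_orthogonal (i j : 'I_(d * k).+1) :
  star (progression_family i) * progression_family j = (i == j)%:R.
Proof.
wlog ij : i j / (i %/ d <= j %/ d)%N => [wlog_ij|].
  have [/wlog_ij//|/ltnW/wlog_ij] := leqP (i %/ d) (j %/ d).
  move/(congr1 (@star _ A)); rewrite starM starK => ->.
  by rewrite eq_sym; case: (_ == _); rewrite ?star1 ?raddf0.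
move: ij; rewrite leq_eqVlt => /predU1P[ij|ij]; last first.
  have i_lt : (i < d * k)%N.
    rewrite -div_ltE (leq_trans ij)//.
    by rewrite -[leqRHS](mulKn k d_gt0) leq_div2r// -ltnS.
  rewrite /progression_family i_lt star_progression_orthogonal//.
    by case: eqP ij => // ->; rewrite ltnn.
  by rewrite insubd_neq// ltn_mod.
rewrite {1}/progression_family starM -mulrA (mulrA (star (sl ^+ _))).
rewrite ij (starX_mulX s_rel) mul1r -!div_ltE ij.
have [jk|kj] := ltnP (j %/ d) k; last first.
  suff -> : i = j by rewrite eqxx star1 mulr1.
  have val_last (h : 'I_(d * k).+1) : (k <= h %/ d)%N -> h = ord_max.
    rewrite leqNgt div_ltE -leqNgt => h_ge; apply: val_inj => /=.
    by apply/anti_leq; rewrite h_ge -ltnS ltn_ord.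
  by rewrite (val_last i) ?ij// (val_last j).
rewrite s_rel.1; congr (_%:R); congr (nat_of_bool _).
rewrite -!val_eqE /= !insubd_lt ?ltn_mod//.
by rewrite [in RHS](divn_eq i d) [in RHS](divn_eq j d) ij eqn_add2l.
Qed.

End Family.

Lemma pure_of_progression l k zeta zm omega b : is_state omega ->
  (0 < k)%N -> omega (star b * b) = 0 ->
  (forall phi, positive phi -> phi (star b * b) = 0 ->
    progression s l k zeta zm phi) ->
  (`|zm| < 1) \/ k = 1%N -> pure_state omega.
Proof.
move=> st k0 b0 prog zm_k; apply: (unique_pure st b0) => phi st' b0' x.
have [[pos omega1] [pos' phi1]] := (st, st').
have delta1 : (phi \- omega) 1 = 0 by rewrite /= omega1 phi1 subrr.
have bdd := bounded_functionalB (state_bounded st') (state_bounded st).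
have herm := hermitian_functionalB (positive_hermitian pos')
  (positive_hermitian pos).
have progB := progressionB (prog _ pos' b0') (prog _ pos b0).
suff : (phi \- omega) x = 0 by move/eqP; rewrite /= subr_eq0 => /eqP.
case: zm_k => [zm1|k1].
  exact: (progression_unique s_rel k0 s_gen bdd herm progB zm1 delta1).
apply: (progression_eq0 s_rel k0 s_gen bdd herm progB).
rewrite k1 => -[|//] [|//] _ _; rewrite star1 mulr1; exact: delta1.
Qed.

Section Periodic.
Variables (l : 'I_n) (k : nat) (zm : R[i]) (omega : {scalar A}).
Hypotheses (k_gt0 : (0 < k)%N) (omega_state : is_state omega).
Hypothesis omega_prog : progression s l k (fun _ _ => 0) zm omega.
Let sl := s l.

(** The difference of the two sides is a progression with the same coefficients, and [expand_powers]
    makes it vanish on powers, so [progression_eq0] applies. *)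
Lemma sandwich_generator x : omega (sl * x * star sl) = omega x.
Proof.
have [[pos omega1] [prog_s prog_k]] := (omega_state, omega_prog).
(* Exponent [k] is included because the left factor [sl] shifts [r] to [r.+1]. *)
have kill y r i : i != l -> (r <= k)%N -> omega (y * star (sl ^+ r * s i)) = 0.
  move=> il; rewrite leq_eqVlt => /predU1P[->|rk].
    rewrite starM mulrA prog_k; have := prog_s 0%N i y k_gt0 il.
    by rewrite mul1r => ->; rewrite mul0r mulr0.
  by rewrite prog_s// mul0r.
pose delta : {scalar A} := sandwich omega sl (star sl) \- omega.
have deltaE y : delta y = omega (sl * y * star sl) - omega y by [].
suff : delta x = 0 by move/eqP; rewrite deltaE subr_eq0 => /eqP.
have bdd : bounded_functional delta.
  apply: bounded_functionalB (state_bounded omega_state).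
  exact: sandwich_bounded (state_bounded omega_state).
have herm : hermitian_functional delta.
  apply: hermitian_functionalB (positive_hermitian pos).
  exact/positive_hermitian/sandwich_positive.
apply: (progression_eq0 s_rel (l := l) (zeta := fun _ _ => 0) (zm := zm)
  k_gt0 s_gen bdd herm) => [|a b ak bk].
  split=> [r i y rk il|y]; rewrite !deltaE.
    rewrite mulrA -(mulrA (sl * y)) -starM mulrA -exprS kill//.
    by rewrite kill ?(ltnW rk)// subr0 mul0r.
  rewrite mulrA -(mulrA (sl * y)) -starM -exprS exprSr starM mulrA !prog_k.
  by rewrite -mulrBr.
rewrite deltaE [in X in _ - X](expand_powers s_rel l a b) linearD linear_sum /=.
rewrite big1 ?addr0 => [|i il]; last by rewrite kill// ltnW.
by rewrite mulrA -exprS -mulrA -starM -exprS subrr.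
Qed.

(* Both (1 + c sl) / 2 and (1 - c sl) / 2 split off a positive part of omega,
   and purity makes the two parts proportional to omega. *)
Lemma pure_symmetrized (c : R[i]) : c * c^* = 1 -> pure_state omega ->
  exists kappa, forall x,
    c * omega (sl * x) + c^* * omega (x * star sl) = kappa * omega x.
Proof.
move=> c1 pure; have [pos omega1] := omega_state.
pose u (e : R[i]) : A := 2^-1 *: (1 + e *: sl).
pose psi e : {scalar A} := sandwich omega (u e) (star (u e)).
have psiE e x : e * e^* = 1 -> psi e x =
    2^-1 * omega x + 4^-1 * (e * omega (sl * x) + e^* * omega (x * star sl)).
  move=> e1; have -> : psi e x = omega (u e * x * star (u e)) by [].
  have -> : u e * x * star (u e) = 4^-1 *: (x + e^* *: (x * star sl) +
      (e *: (sl * x) + (e * e^*) *: (sl * x * star sl))).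
    have -> : 4^-1 = 2^-1 * 2^-1 :> R[i] by rewrite -invfM -natrM.
    rewrite -(scalerA 2^-1 2^-1) /u starZ starD starZ star1 fmorphV rmorph_nat.
    rewrite -!scalerAl -!scalerAr; do 2!congr (_ *: _).
    rewrite !mulrDl !mulrDr !mul1r !mulr1 -!scalerAl -!scalerAr.
    by rewrite scalerA.
  by rewrite e1 scale1r scalarZ !linearD !scalarZ /= sandwich_generator; field.
have cN1 : (- c) * (- c)^* = 1 by rewrite rmorphN mulrNN.
have compl x : omega x - psi c x = psi (- c) x.
  by rewrite !psiE// rmorphN /=; field.
have pos_psi e : positive (psi e) by exact: sandwich_positive.
have pos_compl : positive (omega \- psi c).
  by move=> a; rewrite /= compl; apply: pos_psi.
have psi_omega := pure_component pure (pos_psi c) pos_compl.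
exists (4 * (psi c 1 - 2^-1)) => x.
have := psi_omega x; rewrite {1}psiE// => /(canRL (addKr _)) E.
have {}E := congr1 ( *%R 4) E; rewrite mulVKf ?pnatr_eq0// in E.
by rewrite E; ring.
Qed.

Lemma pure_eigenvalue : pure_state omega ->
  exists q, forall x, omega (x * star sl) = q * omega x.
Proof.
move=> pure.
have [k1 E1] : exists kappa, forall x,
    1 * omega (sl * x) + 1^* * omega (x * star sl) = kappa * omega x.
  by apply: pure_symmetrized; rewrite ?rmorph1 ?mulr1.
have [k2 E2] : exists kappa, forall x,
    'i * omega (sl * x) + 'i^* * omega (x * star sl) = kappa * omega x.
  by apply: pure_symmetrized; rewrite // conjCi mulrN -expr2 sqrCi opprK.
(* The first equation plus ['i] times the second cancels [omega (sl * x)] and doubles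
   [omega (x * star sl)]. *)
exists (2^-1 * (k1 + 'i * k2)) => x; rewrite -mulrA mulrDl -E1 -mulrA -E2.
have i2 : 'i * 'i = -1 :> R[i] by rewrite -expr2 sqrCi.
rewrite rmorph1 conjCi; set P := omega (sl * x); set Q := omega (x * star sl).
transitivity (2^-1 * (P + Q + ('i * 'i * P - 'i * 'i * Q))); last by field.
by rewrite i2; field.
Qed.

End Periodic.
End GeometricProgression.

(** * Index arithmetic and the characterization of purity *)

Lemma progression_index_lt d k r i :
  (r < k)%N -> (i < d)%N -> (d * r + i < d * k)%N.
Proof.
move=> rk id; apply: (@leq_trans (d * r.+1)); last exact: leq_mul.
by rewrite mulnS addnC ltn_add2r.
Qed.

Lemma neq_last_ord_lt n (hn : (2 <= n)%N) (i : 'I_n) :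
  i != last_ord hn -> (i < n - 1)%N.
Proof.
by move=> il; rewrite subn1 ltn_neqAle -ltnS prednK ?ltn_ord ?andbT// ltnW.
Qed.

(** One [b] serves every positive functional vanishing at its square, so the relations pass to the
    convex components of [omega]. *)
Lemma geometric_progression_eigenvector (R : realType) (n k : nat)
    (hn : (2 <= n)%N) (A : cstarAlgType R[i]) (s : 'I_n -> A)
    (z : 'rV[R[i]]_((n - 1) * k).+1) (omega : {scalar A}) :
  cuntz_relations s -> geometric_progression_state hn s z omega ->
  exists2 b, omega (star b * b) = 0 &
    forall phi : {scalar A}, positive phi -> phi (star b * b) = 0 ->
      progression s (last_ord hn) k
        (fun r i => z 0 (inord ((n - 1) * r + i))) (z 0 ord_max) phi.
Proof.
move=> s_rel [st z1 omega_s omega_k].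
have d_gt0 : (0 < n - 1)%N by rewrite subn_gt0.
have lE : last_ord hn = (n - 1)%N :> nat by rewrite subn1.
pose t := progression_family s (last_ord hn) (n - 1) k.
have t_orth := progression_family_orthogonal s_rel d_gt0 lE (k := k).
have t_last : t ((n - 1) * k)%N = s (last_ord hn) ^+ k.
  exact: progression_family_last.
have omega_t (j : 'I_((n - 1) * k).+1) : omega (t j) = (z 0 j)^*.
  have := ltn_ord j; rewrite ltnS leq_eqVlt => /predU1P[jE|j_lt].
    by rewrite jE t_last omega_k; congr (z 0 _)^*; apply: val_inj.
  have r_lt : (j %/ (n - 1) < k)%N by rewrite ltn_divLR// [(k * _)%N]mulnC.
  have i_lt : (j %% (n - 1) < n - 1)%N by rewrite ltn_mod.
  pose i := Ordinal (leq_trans i_lt (leq_subr 1 n)).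
  have jE : j = ((n - 1) * (j %/ (n - 1)) + i)%N :> nat.
    by rewrite [((n - 1) * (_ %/ _))%N]mulnC -divn_eq.
  rewrite [in LHS]jE /t progression_familyE// omega_s// -jE.
  by congr (z 0 _)^*; apply: val_inj; rewrite /= inordK.
have [b b0 eigen] := unit_family_eigenvector t_orth st z1 omega_t.
exists b => // phi pos phi0; split=> [r i x rk il|x].
  have i_lt := neq_last_ord_lt il.
  have j_lt := progression_index_lt rk i_lt.
  have := eigen phi pos phi0 (inord ((n - 1) * r + i)) x.
  by rewrite inordK ?ltnS ?(ltnW j_lt)// progression_familyE.
have := eigen phi pos phi0 ord_max x.
by rewrite progression_family_last.
Qed.

Theorem corollary1p7 (R : realType) (n k : nat) (hn : (2 <= n)%N) (hk : (2 <= k)%N)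
    (A : cstarAlgType R[i]) (s : 'I_n -> A) (hA : is_cuntz_algebra s)
    (z : 'rV[R[i]]_((n - 1) * k).+1) (omega : {scalar A})
    (homega : geometric_progression_state hn s z omega) :
  pure_state omega <->
  (`|z 0 ord_max| < 1) \/
  (`|z 0 ord_max| = 1 /\
   exists q : R[i], q ^+ k = z 0 ord_max /\
     is_cuntz_state s (\row_j (if j == last_ord hn then q else 0)) omega).

Proof.
have [s_rel s_gen _] := hA; have [st z1 omega_s omega_k] := homega.
have [pos omega1] := st; have k_gt0 : (0 < k)%N by rewrite ltnW.
have [b b0 prog] := geometric_progression_eigenvector s_rel homega.
have zm_le1 : `|z 0 ord_max| <= 1.
  rewrite -(@ler_pXn2r _ 2) ?nnegrE// expr1n -z1 (bigD1 ord_max)//= lerDl.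
  by rewrite sumr_ge0// => j _; rewrite exprn_ge0.
split=> [pure|[zm_lt1|[_ [q [_ [_ q_unit omega_q]]]]]]; last first.
(* The eigenvector relations of a Cuntz state are a progression with [k = 1], so purity holds
   although the last coordinate has modulus 1. *)
- pose y : 'rV[R[i]]_n := \row_j (if j == last_ord hn then q else 0).
  have [c c0 eigen] := unit_family_eigenvector s_rel.1 st q_unit omega_q.
  apply: (pure_of_progression (l := last_ord hn) (k := 1) s_rel s_gen
    (zeta := fun _ j => y 0 j) (zm := y 0 (last_ord hn)) st _ c0) => //.
    move=> phi phi_pos phi0; split=> [[|//] r x _ _|x].
      by rewrite mul1r; apply: eigen.
    exact: eigen.
  by right.
- by apply: (pure_of_progression s_rel s_gen st k_gt0 b0 prog); left.
move: zm_le1; rewrite le_eqVlt => /predU1P[zm1|]; last by left.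
right; split=> //.
have z0 (j : 'I_((n - 1) * k).+1) : j != ord_max -> z 0 j = 0.
  move=> j_max; apply/eqP; move/eqP: z1.
  rewrite (bigD1 ord_max)//= zm1 expr1n -subr_eq0 addrAC subrr add0r.
  rewrite psumr_eq0 => [|h _]; last exact: exprn_ge0.
  by move/allP/(_ j (mem_index_enum _)); rewrite j_max expf_eq0 normr_eq0.
have prog0 : progression s (last_ord hn) k (fun _ _ => 0) (z 0 ord_max) omega.
  have [prog_s prog_k] := prog omega pos b0; split=> // r i x rk il.
  have j_lt := progression_index_lt rk (neq_last_ord_lt il).
  by rewrite prog_s// z0// -val_eqE /= inordK ?ltnS 1?ltnW// ltn_eqF.
have [q omega_q] := pure_eigenvalue s_rel s_gen k_gt0 st prog0 pure.
have omega_qX r : omega (star (s (last_ord hn) ^+ r)) = q ^+ r.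
  elim: r => [|r IHr]; first by rewrite star1 omega1.
  by rewrite exprS starM omega_q IHr -exprS.
exists q; have qk : q ^+ k = z 0 ord_max.
  by have [_] := prog0; move/(_ 1); rewrite mul1r omega_qX omega1 mulr1.
have q1 : `|q| = 1.
  by apply/eqP; rewrite -(pexpr_eq1 k_gt0)// -normrX qk zm1.
split=> //; split=> // [|j]; rewrite ?mxE.
  rewrite /unit_vector (bigD1 (last_ord hn))//= mxE eqxx q1 expr1n.
  rewrite big1 ?addr0// => j /negbTE j_l.
  by rewrite mxE j_l normr0 expr0n.
case: eqP => [->|/eqP j_l].
  have := omega_qX 1%N; rewrite !expr1 (positive_hermitian pos) => <-.
  by rewrite conjCK.
have [prog_s _] := prog0; have := prog_s 0%N j 1 k_gt0 j_l.
rewrite !mul1r mul0r (positive_hermitian pos) => /eqP.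
by rewrite conjC_eq0 conjC0 => /eqP.
Qed.
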